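(* Let $p$ be a prime and $q=p^m$ for a positive integer $m$. Let $J=\{x^q-x: x\in\mathbb{F}_{q^2}\}$, let $g\in\mathbb{F}_{q^2}[x]$ satisfy $g(J)\subseteq J$, let $\phi(x)=\sum_i a_ix^{q^i}$ with all $a_i\in\mathbb{F}_q$, let $s\in\{p^h+p^k: 1\le h\le k\le 2m-1\}$ and $b\in\mathbb{F}_q^*$, and put $f(x)=b\phi(x)+(g(x^q-x))^s$. If $f$ is a permutation polynomial of $\mathbb{F}_{q^2}$, then $f$ is PcN over $\mathbb{F}_{q^2}$ for every $c\in\mathbb{F}_q\setminus\{1\}$.
   Context: For $f:\mathbb{F}_{Q}\to\mathbb{F}_{Q}$ and $c\in\mathbb{F}_Q$, ${}_c\Delta_f(a,b)=\#\{x\in\mathbb{F}_Q: f(x+a)-cf(x)=b\}$ and ${}_c\Delta_f=\max\{{}_c\Delta_f(a,b): a,b\in\mathbb{F}_Q,\ (a,c)\neq(0,1)\}$; $f$ is PcN if ${}_c\Delta_f\le 1$. *)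

(* Defs.v *)
From HB Require Import structures.
From mathcomp Require Import all_boot all_order all_algebra.

Set Implicit Arguments.
Unset Strict Implicit.
Unset Printing Implicit Defensive.

Import GRing.Theory.
Local Open Scope ring_scope.

Definition cDelta_at (F : finFieldType) (f : F -> F) (c a b : F) : nat :=
  #|[set x : F | f (x + a) - c * f x == b]|.

Definition cDelta (F : finFieldType) (f : F -> F) (c : F) : nat :=
  \max_(ab : F * F | (ab.1, c) != (0, 1)) cDelta_at f c ab.1 ab.2.

Definition PcN (F : finFieldType) (f : F -> F) (c : F) : Prop :=
  (cDelta f c <= 1)%N.

Definition permutation_poly (F : finFieldType) (f : {poly F}) : Prop :=
  bijective (horner f).

Definition Jset (F : finFieldType) (q : nat) : {set F} :=
  [set x ^+ q - x | x : F].

(* When #|Fq| = q and #|F| = q ^ 2, the embedding incl identifies Fq with the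
   subfield F_q of F; frob_poly is then the q-polynomial with coefficients a_i. *)
Definition frob_poly (Fq F : finFieldType) (incl : {rmorphism Fq -> F})
    (q n : nat) (a : 'I_n -> Fq) : {poly F} :=
  \sum_(i < n) incl (a i) *: 'X^(q ^ i).

(* Main.v *)
(* Write T x = x^q - x, so that J = T(F) and every u in J satisfies u^q = - u.
   Since s = p^h + p^k, u^s is then fixed by the Frobenius x |-> x^q, so T kills
   the term g(T x)^s and T (f x) = b phi(T x). As f is onto, b phi maps J onto
   itself, hence is injective on J.
   If f(x+a) - c f(x) = f(y+a) - c f(y), applying T gives
   (1-c) b phi(T x) = (1-c) b phi(T y), so T x = T y; the terms in g then agree
   for x and y, as for x+a and y+a, which leaves phi x = phi y, so f x = f y. *)
Require Import Defs.
From HB Require Import structures.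
From mathcomp Require Import all_boot all_order all_algebra all_field.
From mathcomp Require Import ring.

Set Implicit Arguments.
Unset Strict Implicit.
Unset Printing Implicit Defensive.

Import GRing.Theory.
Local Open Scope ring_scope.

Lemma horner_frob_poly (Fq F : finFieldType) (incl : {rmorphism Fq -> F})
    (q n : nat) (a : 'I_n -> Fq) (x : F) :
  (frob_poly incl q a).[x] = \sum_(i < n) incl (a i) * x ^+ (q ^ i).
Proof. by rewrite horner_sum; apply: eq_bigr => i _; rewrite !hornerE. Qed.

Lemma exprBn_pchar (R : comNzRingType) (x y : R) (n : nat) :
  [pchar R].-nat n -> (x - y) ^+ n = x ^+ n - y ^+ n.
Proof. by move=> Rn; rewrite exprDn_pchar// exprNn_pchar. Qed.

Lemma frob_polyB (Fq F : finFieldType) (incl : {rmorphism Fq -> F})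
    (q n : nat) (a : 'I_n -> Fq) (x y : F) :
  [pchar F].-nat q ->
  (frob_poly incl q a).[x - y] = (frob_poly incl q a).[x] - (frob_poly incl q a).[y].
Proof.
move=> Fqn; rewrite !horner_frob_poly -sumrB; apply: eq_bigr => i _.
by rewrite exprBn_pchar ?mulrBr// pnatX Fqn.
Qed.

Lemma incl_expr_card (Fq F : finFieldType) (incl : {rmorphism Fq -> F}) (c : Fq) :
  incl c ^+ #|Fq| = incl c.
Proof. by rewrite -rmorphXn expf_card. Qed.

(** The power map with exponent [#|Fq|] is additive here and fixes the coefficients, which come from
    [Fq], so it acts on [x] alone. *)
Lemma frob_poly_expr (Fq F : finFieldType) (incl : {rmorphism Fq -> F})
    (n : nat) (a : 'I_n -> Fq) (x : F) :
  [pchar F].-nat #|Fq| ->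
  (frob_poly incl #|Fq| a).[x] ^+ #|Fq| = (frob_poly incl #|Fq| a).[x ^+ #|Fq|].
Proof.
move=> Fqn; rewrite !horner_frob_poly.
have expr_sum (r : seq 'I_n) (G : 'I_n -> F) :
    (\sum_(i <- r) G i) ^+ #|Fq| = \sum_(i <- r) G i ^+ #|Fq|.
  elim: r => [|i r IHr]; last by rewrite !big_cons exprDn_pchar// IHr.
  (* The empty sum needs [0 ^+ #|Fq| = 0], which holds because [#|Fq|] is nonzero. *)
  by rewrite !big_nil expr0n -leqn0 leqNgt (ltnW (finNzRing_gt1 Fq)).
rewrite expr_sum; apply: eq_bigr => i _.
by rewrite exprMn incl_expr_card -!exprM mulnC.
Qed.

(** As [#|F| = q ^ 2], applying the [q]-th power twice gives the identity, so it swaps the two terms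
    of [x ^+ q - x]. *)
Lemma Jset_expr (F : finFieldType) (q : nat) (u : F) :
  [pchar F].-nat q -> #|F| = (q ^ 2)%N -> u \in Jset F q -> u ^+ q = - u.
Proof.
move=> Fqn hF /imsetP[x _ ->].
by rewrite exprBn_pchar// -exprM mulnn -hF expf_card opprB.
Qed.

(** Each of the two powers of [p] in the exponent contributes one sign, in characteristic 2 as well,
    and the two signs cancel. *)
Lemma Jset_pow_fixed (F : finFieldType) (p q h k : nat) (u : F) :
  p \in [pchar F] -> u ^+ q = - u ->
  (u ^+ (p ^ h + p ^ k)) ^+ q = u ^+ (p ^ h + p ^ k).
Proof.
move=> pF uq; have Fpn i : [pchar F].-nat (p ^ i)%N.
  by rewrite pnatX pnatE ?pF// (pcharf_prime pF).
by rewrite exprAC uq exprD !exprNn_pchar// mulrNN -exprD.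
Qed.

Lemma PcN_inj (F : finFieldType) (f : F -> F) (c : F) :
  (forall a, injective (fun x => f (x + a) - c * f x)) -> PcN f c.
Proof.
move=> finj; rewrite /PcN; apply/bigmax_leqP => -[a b] _; apply/card_le1_eqP.
move=> x y; rewrite !inE /= => /eqP xb /eqP yb.
by apply: (finj a); rewrite xb yb.
Qed.

Theorem theorem3p10 (p m q : nat) (hp : prime p) (hm : (0 < m)%N)
    (hq : q = (p ^ m)%N)
    (Fq F : finFieldType) (hFq : #|Fq| = q) (hF : #|F| = (q ^ 2)%N)
    (incl : {rmorphism Fq -> F})
    (g : {poly F}) (hg : [set g.[y] | y in Jset F q] \subset Jset F q)
    (n : nat) (a : 'I_n -> Fq)
    (s : nat)
    (hs : exists h k : nat,
        [/\ (1 <= h)%N, (h <= k)%N, (k <= 2 * m - 1)%N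
          & s = (p ^ h + p ^ k)%N])
    (b : Fq) (hb : b != 0)
    (f : {poly F})
    (hf : f = incl b *: frob_poly incl q a + (g \Po ('X^q - 'X)) ^+ s)
    (hperm : permutation_poly f)
    (c : Fq) (hc : c != 1) :
  PcN (horner f) (incl c).
Proof.
case: hs => h [k [_ _ _ sE]].
have pF : p \in [pchar F].
  by apply: (@card_finPcharP _ _ (m * 2)); rewrite // expnM -hq.
have qF : [pchar F].-nat q by rewrite hq pnatX pnatE ?pF.
pose phi x := (frob_poly incl q a).[x].
pose T (x : F) := x ^+ q - x.
pose G x := g.[T x] ^+ s.
have fE x : f.[x] = incl b * phi x + G x by rewrite hf !hornerE horner_comp !hornerE.
have phiB x y : phi (x - y) = phi x - phi y by exact: frob_polyB.
have TB x y : T (x - y) = T x - T y.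
  by rewrite /T exprBn_pchar// opprD addrACA -opprD.
have TM e x : T (incl e * x) = incl e * T x.
  by rewrite /T exprMn -{1}hFq incl_expr_card mulrBr.
have Tphi x : T (phi x) = phi (T x).
  by rewrite /T phiB /phi -hFq frob_poly_expr ?hFq.
have TJ x : T x \in Jset F q by apply: imset_f.
have TG x : T (G x) = 0.
  have gJ : g.[T x] \in Jset F q by apply: (subsetP hg); apply: imset_f.
  by rewrite /T /G sE (Jset_pow_fixed _ _ pF (Jset_expr qF hF gJ)) subrr.
have TD x y : T (x + y) = T x + T y.
  by rewrite /T exprDn_pchar// opprD addrACA.
have Tf x : T f.[x] = incl b * phi (T x) by rewrite fE TD TM TG addr0 Tphi.
have bphi_inj : {in Jset F q &, injective (fun y => incl b * phi y)}.
  (* On the finite set [J], injectivity follows once the image contains [J]; by [Tf], the element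
     [T z] is the image of [T (f' z)]. *)
  apply/imset_injP; rewrite eqn_leq leq_imset_card subset_leq_card//.
  apply/subsetP => _ /imsetP[z _ ->]; case: hperm => f' _ f'K.
  by apply/imsetP; exists (T (f' z)); rewrite // -Tf f'K.
have c_neq0 : 1 - incl c != 0.
  by rewrite subr_eq0 eq_sym -(rmorph1 incl) (inj_eq (fmorph_inj incl)).
apply: PcN_inj => d x y /= fxy.
have phiD z w : phi (z + w) = phi z + phi w.
  (* Additivity comes from [phiB] alone: write [z + w] as [z - (0 - w)], and [0] as [w - w] to get
     [phi 0 = 0]. *)
  by rewrite -{1}[w]opprK phiB -[- w]sub0r !phiB -[0](subrr w) phiB subrr sub0r opprK.
have TDelta z : T (f.[z + d] - incl c * f.[z]) =
    (1 - incl c) * (incl b * phi (T z)) + incl b * phi (T d).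
  by rewrite TB TM !Tf TD phiD; ring.
have Txy : T x = T y.
  apply: bphi_inj => //=; apply: (mulfI c_neq0).
  by apply: (addIr (incl b * phi (T d))); rewrite -!TDelta fxy.
have Gxy : G x = G y by rewrite /G Txy.
have Gxyd : G (x + d) = G (y + d) by rewrite /G !TD Txy.
(* Since [f] is a permutation, equal values suffice; with [Gxy] only the [phi] terms remain to be
   compared. *)
apply: (bij_inj hperm); rewrite !fE Gxy; congr (_ + _).
apply: (mulfI c_neq0).
(* The last bracket depends on [z] only through [G z] and [G (z + d)], so it is the same at [x] and
   [y] and cancels. *)
have DeltaE z : f.[z + d] - incl c * f.[z] =
    (1 - incl c) * (incl b * phi z) + (incl b * phi d + G (z + d) - incl c * G z).
  by rewrite !fE phiD; ring.
by move: fxy; rewrite !DeltaE Gxy Gxyd => /addIr.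
Qed.
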